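(* Let $\mathbb{F}_q$ be a finite field, let $k,m\geqslant 1$ and $n\geqslant 2$ be integers and let $\mathcal{V}=\{\mathbf{v}_1,\dots,\mathbf{v}_m\}\subseteq\mathbb{N}^n$. Assume that $\mathcal{V}$ satisfies property $V_2(k)$. Then the polynomials in $P(k,\mathcal{V})$ are linearly independent over $\mathbb{F}_q(x_1,\dots,x_n)$.
   Context: $\mathbb{N}=\{0,1,2,\dots\}$ and $[n]:=\{1,\dots,n\}$. $\mathbb{F}_q(x_1,\dots,x_n)$ is the field of rational functions in the formal variables $x_1,\dots,x_n$ over $\mathbb{F}_q$, and $x$ is a further formal variable. For $\mathbf{v}\in\mathbb{N}^n$, $\mathbf{v}(i)$ is its $i$-th coordinate and $|\mathbf{v}|:=\sum_{i=1}^n\mathbf{v}(i)$. For $\mathcal{V}=\{\mathbf{v}_1,\dots,\mathbf{v}_m\}\subseteq\mathbb{N}^n$ and nonempty $I\subseteq[m]$, let $\mu_{\mathcal{V}}(I)=(\min_{i\in I}\mathbf{v}_i(1),\dots,\min_{i\in I}\mathbf{v}_i(n))$. For integers $k,m,n\geqslant 1$ and $0\leqslant l\leqslant n$, $\mathcal{V}=\{\mathbf{v}_1,\dots,\mathbf{v}_m\}\subseteq\mathbb{N}^n$ satisfies property $V_l(k)$ if: (I) $|\mathbf{v}_i|\leqslant k-1$ for all $i\in[m]$; (II) for all nonempty $I\subseteq[m]$, $\sum_{i\in I}(k-|\mathbf{v}_i|)+|\mu_{\mathcal{V}}(I)|\leqslant k$; (III) $\mathbf{v}_i\in\{0,1\}^{n-l}\times\mathbb{N}^l$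 for all $i\in[m]$. For $k>|\mathbf{v}|$, $P(k,\mathbf{v}):=\left\{\prod_{j\in[n]}(x-x_j)^{\mathbf{v}(j)}x^e : e=0,\dots,k-1-|\mathbf{v}|\right\}\subseteq \mathbb{F}_q(x_1,\dots,x_n)[x]$, and $P(k,\mathcal{V})=P(k,\mathbf{v}_1)\cup\dots\cup P(k,\mathbf{v}_m)$, understood as a multiset union (so $|P(k,\mathcal{V})|=\sum_i|P(k,\mathbf{v}_i)|$). *)

(* Defs.v *)
From mathcomp Require Import all_boot all_order all_algebra.
From mathcomp Require Import mpoly.

Set Implicit Arguments.
Unset Strict Implicit.
Unset Printing Implicit Defensive.

Import GRing.Theory.

Local Open Scope ring_scope.

(* [|v|] is [mdeg v], and the family [V : 'I_m -> 'X_{1..n}] lists the vectors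
   v_1, ..., v_m, with 0-based indices for both vectors and coordinates. *)

(* The neutral element of the iterated minimum is the maximum over the same
   index set, so it has no effect when [I] is nonempty. *)
Definition mu (m n : nat) (V : 'I_m -> 'X_{1..n}) (I : {set 'I_m}) : 'X_{1..n} :=
  [multinom (\big[minn / (\max_(i in I) V i j)]_(i in I) V i j)%N | j < n].

(* The truncated subtractions [k - 1] and [k - mdeg (V i)] are exact for
   [0 < k], by the first clause. *)
Definition property_V (l k m n : nat) (V : 'I_m -> 'X_{1..n}) : Prop :=
  [/\ forall i : 'I_m, (mdeg (V i) <= k - 1)%N,
      forall I : {set 'I_m}, I != set0 ->
        ((\sum_(i in I) (k - mdeg (V i))) + mdeg (mu V I) <= k)%N
    & forall (i : 'I_m) (j : 'I_n), (j < n - l)%N -> V i j \in [:: 0%N; 1%N]].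

Definition ratvar (F : fieldType) (n : nat) (j : 'I_n) : {fraction {mpoly F[n]}} :=
  tofrac ('X_j : {mpoly F[n]}).

(* Lists of polynomials represent multisets. *)
Definition Pvec (F : fieldType) (n k : nat) (v : 'X_{1..n}) :
    seq {poly {fraction {mpoly F[n]}}} :=
  [seq (\prod_(j < n) ('X - (ratvar F j)%:P) ^+ v j) * 'X^e
     | e <- iota 0 (k - mdeg v)].

Definition Pfam (F : fieldType) (m n k : nat) (V : 'I_m -> 'X_{1..n}) :
    seq {poly {fraction {mpoly F[n]}}} :=
  flatten [seq Pvec F k (V i) | i <- enum 'I_m].

(* Same condition as in the library's [freeP], which requires a
   finite-dimensional ambient space. *)
Definition lin_indep (K : fieldType) (E : lmodType K) (s : seq E) : Prop :=
  forall c : 'I_(size s) -> K,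
    \sum_(i < size s) c i *: s`_i = 0 -> forall i, c i = 0.

(* Main.v *)
Require Import Defs.
From mathcomp Require Import all_boot all_order all_algebra.
From mathcomp Require Import mpoly.
From mathcomp Require Import zify.

Set Implicit Arguments.
Unset Strict Implicit.
Unset Printing Implicit Defensive.

Import GRing.Theory.

Local Open Scope ring_scope.

(* Write p_v for the product of the (x - x_j)^v(j). Linear independence means
   that a relation sum_i c_i p_(v_i) = 0 with size c_i <= k - |v_i| is trivial,
   and after clearing denominators the c_i have coefficients in F[x_1, ..., x_n].
   Induct on k, the number of vectors and the sum of their 0/1 coordinates.
   If a set I of size 1 < |I| < m is tight with minimum u, then the vectors in I
   may be replaced by the single vector u, and both smaller families are
   independent. If at most one vector vanishes at the last coordinate n, dividing
   by x - x_n lowers k. If two vectors vanish there, then (II) for this pair shows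
   that they differ at some 0/1 coordinate j; without tight sets, specializing x_j
   to x_n, i.e. adding the coordinate j to the coordinate n, preserves (II). *)

(** * Exponent vectors, admissible families and independence *)

Definition weight (n : nat) (v : 'I_n -> nat) : nat := \sum_j v j.

Definition upd (n : nat) (v : 'I_n -> nat) (q : 'I_n) (a : nat) : 'I_n -> nat :=
  fun j => if j == q then a else v j.

(** For [j != q], the exponents of a root polynomial after [x j] is specialized to [x q]. *)
Definition merge (n : nat) (j q : 'I_n) (v : 'I_n -> nat) : 'I_n -> nat :=
  upd (upd v q (v q + v j)) j 0.

Definition lower (n : nat) (T : finType) (V : T -> 'I_n -> nat) (I : {set T})
    (u : 'I_n -> nat) : Prop :=
  forall i, i \in I -> forall j, (u j <= V i j)%N.

(* Since the bound is monotone in [u], quantifying over all lower bounds [u] of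
   the family amounts to taking [u] to be the minimum mu(I). *)
Definition admissible (n : nat) (T : finType) (k : nat) (V : T -> 'I_n -> nat)
    (S : {set T}) : Prop :=
  forall I : {set T}, I \subset S -> I != set0 ->
  forall u, lower V I u -> (\sum_(i in I) (k - weight (V i)) + weight u <= k)%N.

Definition root_poly (D : idomainType) (n : nat) (x : 'I_n -> D)
    (v : 'I_n -> nat) : {poly D} :=
  \prod_j ('X - (x j)%:P) ^+ v j.

(** The polynomial [c i] packs the scalars of all multiples by x^e. Working over an integral domain
    leaves room for specializing variables. Subfamilies are subsets [S] of a fixed index type, so a
    replacing vector can reuse an old index. *)
Definition independent (D : idomainType) (n : nat) (x : 'I_n -> D) (T : finType)
    (k : nat) (V : T -> 'I_n -> nat) (S : {set T}) : Prop :=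
  forall c : T -> {poly D},
    (forall i, i \in S -> (size (c i) <= k - weight (V i))%N) ->
    \sum_(i in S) c i * root_poly x (V i) = 0 ->
  forall i, i \in S -> c i = 0.

(** * Coordinate changes and root polynomials *)

Lemma upd_eq n (v : 'I_n -> nat) q a : upd v q a q = a.
Proof. by rewrite /upd eqxx. Qed.

Lemma upd_neq n (v : 'I_n -> nat) q a j : j != q -> upd v q a j = v j.
Proof. by rewrite /upd => /negbTE ->. Qed.

Lemma weight_upd n (v : 'I_n -> nat) q a :
  (weight (upd v q a) + v q = weight v + a)%N.
Proof.
rewrite /weight (bigD1 q) //= [in RHS](bigD1 q) //= upd_eq.
rewrite (eq_bigr v) => [|j jq]; last by rewrite upd_neq.
by lia.
Qed.

Lemma weight_merge n (j q : 'I_n) (v : 'I_n -> nat) :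
  j != q -> weight (merge j q v) = weight v.
Proof.
move=> jq; have := weight_upd (upd v q (v q + v j)) j 0.
have := weight_upd v q (v q + v j).
by rewrite (upd_neq v (v q + v j) jq) -/(merge j q v); lia.
Qed.

Lemma leq_coord_weight n (v : 'I_n -> nat) q : (v q <= weight v)%N.
Proof. by rewrite /weight (bigD1 q) //= leq_addr. Qed.

(** The balancing powers on both sides avoid division and any comparison of [a] with [v q]. *)
Lemma root_poly_upd (D : idomainType) n (x : 'I_n -> D) v q a :
  root_poly x (upd v q a) * ('X - (x q)%:P) ^+ v q =
  root_poly x v * ('X - (x q)%:P) ^+ a.
Proof.
rewrite /root_poly (bigD1 q) //= [in RHS](bigD1 q) //= upd_eq.
rewrite [in LHS](eq_bigr (fun j => ('X - (x j)%:P) ^+ v j)).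
  by rewrite mulrC mulrCA mulrC.
by move=> j jq; rewrite upd_neq.
Qed.

Lemma root_poly_pred (D : idomainType) n (x : 'I_n -> D) v q : (0 < v q)%N ->
  root_poly x v = root_poly x (upd v q (v q).-1) * ('X - (x q)%:P).
Proof.
move=> vq; apply: (@mulIf _ (('X - (x q)%:P) ^+ (v q).-1)).
  by rewrite expf_neq0 // polyXsubC_eq0.
by rewrite -root_poly_upd -mulrA -exprS prednK.
Qed.

Lemma root_polyD (D : idomainType) n (x : 'I_n -> D) u v :
  (forall j, u j <= v j)%N ->
  root_poly x v = root_poly x (fun j => v j - u j)%N * root_poly x u.
Proof.
move=> uv; rewrite /root_poly -big_split; apply: eq_bigr => j _ /=.
by rewrite -exprD subnK.
Qed.

Lemma root_poly_neq0 (D : idomainType) n (x : 'I_n -> D) v : root_poly x v != 0.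
Proof.
by apply/prodf_neq0 => j _; rewrite expf_neq0 // polyXsubC_eq0.
Qed.

Lemma size_root_poly (D : idomainType) n (x : 'I_n -> D) v :
  size (root_poly x v) = (weight v).+1.
Proof.
rewrite /root_poly size_prod => [|j _]; last first.
  by rewrite expf_neq0 // polyXsubC_eq0.
rewrite (eq_bigr (fun j => v j + 1)%N) => [|j _].
  by rewrite big_split /= sum1_card subSn ?leq_addl // addnK.
by rewrite size_exp_XsubC addn1.
Qed.

Lemma root_poly_horner_neq0 (D : idomainType) n (x : 'I_n -> D) v q :
  injective x -> v q = 0%N -> (root_poly x v).[x q] != 0.
Proof.
move=> x_inj vq; rewrite horner_prod; apply/prodf_neq0 => j _.
rewrite horner_exp hornerXsubC.
have [->|jq] := eqVneq j q; first by rewrite vq expr0 oner_neq0.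
by rewrite expf_neq0 // subr_eq0 (inj_eq x_inj) eq_sym.
Qed.

Lemma root_poly_merge (D : idomainType) n (x : 'I_n -> D) (j q : 'I_n) v :
  j != q ->
  root_poly x (merge j q v) = root_poly (fun i => if i == j then x q else x i) v.
Proof.
move=> jq; have qj : q != j by rewrite eq_sym.
rewrite /root_poly (bigD1 j) //= (bigD1 q) //= [RHS](bigD1 j) //=.
rewrite [X in _ = _ * X](bigD1 q) //= /merge upd_eq expr0 mul1r mulrA.
rewrite eqxx (negbTE qj) upd_neq // upd_eq -exprD [(v q + _)%N]addnC.
congr (_ * _); apply: eq_bigr => i /andP[ij iq].
by rewrite (negbTE ij) !upd_neq.
Qed.

Lemma map_root_poly (D : idomainType) n (x : 'I_n -> D) (phi : {rmorphism D -> D}) v :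
  map_poly phi (root_poly x v) = root_poly (phi \o x) v.
Proof.
rewrite /root_poly rmorph_prod; apply: eq_bigr => j _.
by rewrite rmorphXn /= rmorphB /= map_polyX map_polyC.
Qed.

(** * Specializing one variable to another *)

(* Infinite descent on [deg]: the specialization [phi] of [x j] to [x q] kills
   the coefficients of a relation, so these are divisible by [d], and the
   quotients form a relation again. *)
Lemma independent_merge (D : idomainType) n (x : 'I_n -> D) (T : finType) k
    (V : T -> 'I_n -> nat) (S : {set T}) (j q : 'I_n)
    (phi : {rmorphism D -> D}) (d : D) (deg : D -> nat) :
  j != q -> d != 0 ->
  (forall i, phi (x i) = if i == j then x q else x i) ->
  (forall f, phi f = 0 -> exists g, f = d * g) ->
  (forall f, f != 0 -> (deg f < deg (d * f)%R)%N) ->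
  independent x k (fun i => merge j q (V i)) S -> independent x k V S.
Proof.
move=> jq d0 phix phi_ker degM indep c0 size_c0 rel0.
pose dg (c : T -> {poly D}) i e := deg (c i)`_e.
(* [N] bounds [deg] on all nonzero coefficients; at 0 none can be left. *)
have [N c0N] : exists N, forall i e, i \in S -> (c0 i)`_e != 0 -> (dg c0 i e < N)%N.
  exists (\max_(i in S) \max_(e < size (c0 i)) dg c0 i e).+1.
  move=> i e iS nz; apply: leq_trans (leq_bigmax_cond _ iS).
  have [lt|le] := ltnP e (size (c0 i)); last by rewrite nth_default ?eqxx in nz.
  exact: (leq_bigmax (F := fun e : 'I__ => dg c0 i e) (Ordinal lt)).
elim: N c0 size_c0 rel0 c0N => [|N IH] c size_c rel cN.
  move=> i iS; apply/polyP => e; apply/eqP; rewrite coef0.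
  by apply: contraT => /(cN _ _ iS).
(* Applying [phi] to the relation gives one for the merged family. *)
have phi0 : forall i, i \in S -> map_poly phi (c i) = 0.
  apply: indep => [i iS|].
    rewrite weight_merge //; apply: leq_trans (size_c i iS); exact: size_poly.
  rewrite -[RHS](rmorph0 (map_poly phi)) -[in RHS]rel rmorph_sum.
  apply: eq_bigr => i _; rewrite rmorphM /= map_root_poly root_poly_merge //.
  by congr (_ * _); rewrite /root_poly; apply: eq_bigr => i' _ /=; rewrite phix.
have /fin_all_exists[c' Ec] i : exists ci : {poly D},
    i \in S -> c i = d%:P * ci /\ (size ci <= size (c i))%N.
  have [iS|_] := boolP (i \in S); last by exists 0.
  have /fin_all_exists[g Eg] (e : 'I_(size (c i))) : exists g, (c i)`_e = d * g.
    by apply: phi_ker; rewrite -coef_map phi0 // coef0.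
  exists (\poly_(e < size (c i)) (if insub e is Some e' then g e' else 0)).
  move=> _; split; last exact: size_poly.
  apply/polyP => e; rewrite coefCM coef_poly.
  case: insubP => [e' _ <-|/negbTE ge]; first by rewrite ltn_ord -Eg.
  by rewrite ge mulr0 nth_default // leqNgt ge.
(* The factor [d] cancels from the relation, and [degM] lowers the bound for the quotients to
   [N]. *)
have c'0 : forall i, i \in S -> c' i = 0.
  apply: IH => [i iS||i e iS nz].
  - by apply: leq_trans (size_c _ iS); case: (Ec _ iS).
  - apply: (@mulfI _ d%:P); first by rewrite polyC_eq0.
    rewrite mulr0 -[RHS]rel mulr_sumr; apply: eq_bigr => i iS.
    by case: (Ec _ iS) => -> _; rewrite mulrA.
  - have := cN _ e iS; rewrite /dg; case: (Ec _ iS) => -> _; rewrite coefCM mulf_neq0 //.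
    by move=> /(_ isT); exact: leq_trans (degM _ nz).
by move=> i iS; case: (Ec _ iS) => -> _; rewrite c'0 // mulr0.
Qed.

Definition mergeX (F : fieldType) n (j q : 'I_n) : n.-tuple {mpoly F[n]} :=
  [tuple if i == j then 'X_q else 'X_i | i < n].

Lemma comp_mergeX (F : fieldType) n (j q i : 'I_n) :
  'X_i \mPo mergeX F j q = if i == j then 'X_q else 'X_i.
Proof. by rewrite comp_mpolyXU -tnth_nth tnth_mktuple. Qed.

(** Every polynomial is congruent to its image modulo X_j - X_q: this holds for constants and
    variables and is stable under sums and products. *)
Lemma comp_mergeX_ker (F : fieldType) n (j q : 'I_n) (f : {mpoly F[n]}) :
  f \mPo mergeX F j q = 0 -> exists g, f = ('X_j - 'X_q) * g.
Proof.
pose P h := exists g, h = h \mPo mergeX F j q + ('X_j - 'X_q) * g.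
suff [g E] : P f by move=> f0; exists g; rewrite {1}E f0 add0r.
have PD a b : P a -> P b -> P (a + b).
  move=> [g Ea] [h Eb]; exists (g + h); rewrite {1}Ea {1}Eb rmorphD mulrDr.
  by rewrite addrACA.
have PM a b : P a -> P b -> P (a * b).
  rewrite /P rmorphM /=; move: (a \mPo _) (b \mPo _) => A B [g ->] [h ->].
  exists (g * (B + ('X_j - 'X_q) * h) + A * h); rewrite mulrDl [A * (_ + _)]mulrDr.
  rewrite [A * (_ * h)]mulrCA -addrA [X in _ + X = _]addrC.
  by rewrite [in RHS]mulrDr [in RHS]mulrA.
have PC c : P c%:MP by exists 0; rewrite comp_mpolyC mulr0 addr0.
have PX i : P 'X_i.
  rewrite /P comp_mergeX; have [->|_] := eqVneq i j.
    by exists 1; rewrite mulr1 addrC subrK.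
  by exists 0; rewrite mulr0 addr0.
rewrite [f]mpolyE; apply: (big_ind P _ PD) => [|m _]; first by rewrite -mpolyC0.
rewrite -mul_mpolyC mpolyXE_id; apply: (PM) => //.
apply: (big_ind P _ PM) => [|i _]; first by rewrite -mpolyC1.
elim: (m i) => [|e IH]; first by rewrite expr0 -mpolyC1.
by rewrite exprS; apply: PM.
Qed.

Lemma mpolyXU_inj (F : fieldType) n : injective (fun j : 'I_n => 'X_j : {mpoly F[n]}).
Proof.
move=> i j /mpolyP/(_ U_(j)%MM); rewrite !mcoeffXU eqxx.
by case: eqP => //= _ /eqP; rewrite eq_sym oner_eq0.
Qed.

(** The size of a product is the sum of the sizes minus one, and X_j - X_q has size at least 2
    because its monomial X_j does not cancel. *)
Lemma msize_mul_subX (F : fieldType) n (j q : 'I_n) (f : {mpoly F[n]}) :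
  j != q -> f != 0 -> (msize f < msize (('X_j - 'X_q) * f)%R)%N.
Proof.
move=> jq f0; have d0 : 'X_j - 'X_q != 0 :> {mpoly F[n]}.
  by rewrite subr_eq0 (inj_eq (@mpolyXU_inj F n)).
have : U_(j)%MM \in msupp ('X_j - 'X_q : {mpoly F[n]}).
  by rewrite mcoeff_msupp mcoeffB !mcoeffXU eqxx [q == j]eq_sym (negbTE jq) subr0 oner_eq0.
move=> /msize_mdeg_lt; rewrite mdeg1 msizeM //.
by set a := mmeasure _ _; set b := mmeasure _ _; lia.
Qed.

(** * Independence from smaller families: dropping, splitting, dividing *)

Lemma independent_drop (D : idomainType) n (x : 'I_n -> D) (T : finType) k
    (V : T -> 'I_n -> nat) (S : {set T}) i0 : i0 \in S ->
  (k <= weight (V i0))%N -> independent x k V (S :\ i0) -> independent x k V S.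
Proof.
move=> i0S ki0 indep c size_c rel.
have c0 : c i0 = 0.
  by apply/eqP; rewrite -size_poly_eq0 -leqn0; apply: leq_trans (size_c _ i0S) _; lia.
have cS : forall i, i \in S :\ i0 -> c i = 0.
  apply: indep => [i|]; first by rewrite in_setD1 => /andP[_ /size_c].
  by move: rel; rewrite (big_setD1 i0) //= c0 mul0r add0r.
by move=> i iS; have [->//|ii0] := eqVneq i i0; apply: cS; rewrite in_setD1 ii0.
Qed.

(** The terms over [I] add up to a multiple [d] of the root polynomial of [u], so a relation on [S]
    gives one in which [u] stands for all of [I]. There [d] vanishes, which leaves a relation on [I]
    alone. *)
Lemma independent_split (D : idomainType) n (x : 'I_n -> D) (T : finType) k
    (V : T -> 'I_n -> nat) (S I : {set T}) i0 u : I \subset S -> i0 \in I ->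
  lower V I u -> independent x k V I ->
  independent x k (fun i => if i == i0 then u else V i) (i0 |: S :\: I) ->
  independent x k V S.
Proof.
move=> IS i0I uV indepI indepS c size_c rel.
pose d := \sum_(i in I) c i * root_poly x (fun j => V i j - u j)%N.
have sumI : \sum_(i in I) c i * root_poly x (V i) = d * root_poly x u.
  rewrite mulr_suml; apply: eq_bigr => i iI.
  by rewrite -mulrA -root_polyD //; apply: uV.
have i0SI : i0 \notin S :\: I by rewrite in_setD i0I.
have neq i : i \in S :\: I -> (i == i0) = false.
  by move=> iSI; apply/negbTE; apply: contraNneq i0SI => ii0; rewrite -ii0.
have c'0 : forall i, i \in i0 |: S :\: I -> (if i == i0 then d else c i) = 0.
  apply: indepS => [i'|].
    case/setU1P => [->|iSI]; last first.
      by rewrite neq //; apply: size_c; move: iSI; rewrite in_setD => /andP[].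
    (* Each term of [d] has size at most (k - |V i|) + (|V i| - |u|). *)
    rewrite eqxx; apply: leq_trans (size_sum _ _ _) _; apply/bigmax_leqP => i iI.
    have [->|ci0] := eqVneq (c i) 0; first by rewrite mul0r size_poly0.
    rewrite size_mul ?root_poly_neq0 // size_root_poly addnS /=.
    have: weight (V i) = (weight (fun j => V i j - u j) + weight u)%N.
      rewrite /weight -big_split; apply: eq_bigr => j _ /=.
      by rewrite subnK // uV.
    have := size_c _ (subsetP IS _ iI); rewrite -size_poly_gt0 in ci0.
    by move: ci0; set a := size _; lia.
  rewrite big_setU1 //= eqxx -sumI.
  rewrite (big_setID I) /= (setIidPr IS) in rel; rewrite -[RHS]rel.
  by congr (_ + _); apply: eq_bigr => i /neq ->.
have cSI i : i \in S :\: I -> c i = 0.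
  by move=> iSI; have := c'0 i; rewrite neq // => ->//; rewrite in_setU1 iSI orbT.
have d0 : d = 0 by have := c'0 i0; rewrite eqxx setU11 => ->.
have cI : forall i, i \in I -> c i = 0.
  apply: indepI => [i iI|]; last by rewrite sumI d0 mul0r.
  exact: size_c (subsetP IS _ iI).
move=> i iS; have [iI|iI] := boolP (i \in I); first exact: cI.
by apply: cSI; rewrite in_setD iI.
Qed.

Lemma weight_pred n (v : 'I_n -> nat) q :
  weight (upd v q (v q).-1) = (weight v - (0 < v q))%N.
Proof. by have := weight_upd v q (v q).-1; case: (v q) => [|a] /=; lia. Qed.

(* At [x q] all terms of a relation vanish but the one with [V i q = 0], whose
   coefficient is therefore divisible by ['X - x q] as well. *)
Lemma independent_div (D : idomainType) n (x : 'I_n -> D) (T : finType) k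
    (V : T -> 'I_n -> nat) (S : {set T}) q : injective x ->
  (forall i, i \in S -> (weight (V i) < k)%N) ->
  {in S &, forall i i', V i q = 0%N -> V i' q = 0%N -> i = i'} ->
  independent x k.-1 (fun i => upd (V i) q (V i q).-1) S -> independent x k V S.
Proof.
move=> x_inj ltk Vq indep c size_c rel.
have /fin_all_exists[c' Ec] i : exists ci : {poly D}, i \in S ->
    [/\ (size ci <= k.-1 - weight (upd (V i) q (V i q).-1))%N,
        c i * root_poly x (V i) =
        ci * root_poly x (upd (V i) q (V i q).-1) * ('X - (x q)%:P)
      & ci = 0 -> c i = 0].
  have [iS|_] := boolP (i \in S); last by exists 0.
  (* If [V i q] is positive, the coefficient stays while [k] and the weight both drop by one.
     Otherwise the weight stays and the coefficient loses a linear factor. *)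
  have [Vi0|Vi_gt0] := posnP (V i q); last first.
    exists (c i) => _; split=> //; last by rewrite -mulrA -root_poly_pred.
    have := leq_trans Vi_gt0 (leq_coord_weight (V i) q).
    have := size_c _ iS; have := ltk _ iS.
    by rewrite weight_pred Vi_gt0; set a := size _; lia.
  have ci_root : root (c i) (x q).
    apply/eqP/(mulIf (root_poly_horner_neq0 x_inj Vi0)).
    rewrite mul0r -hornerM -[RHS](horner0 (x q)) -[in RHS]rel (big_setD1 i) //=.
    rewrite hornerD horner_sum big1 ?addr0 // => i'.
    rewrite in_setD1 => /andP[i'i i'S]; rewrite (@root_poly_pred _ _ x _ q).
      by rewrite mulrA hornerM hornerXsubC subrr mulr0.
    by rewrite lt0n; apply: contra i'i => /eqP Vi'0; apply/eqP/Vq.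
  have /factor_theorem[ci Eci] := ci_root.
  exists ci => _; split; last by move=> ci0; rewrite Eci ci0 mul0r.
    have [->|ci0] := eqVneq ci 0; first by rewrite size_poly0.
    have := size_c _ iS; rewrite Eci size_Mmonic ?monicXsubC // size_XsubC.
    by rewrite weight_pred Vi0; set a := size _; lia.
  have := root_poly_upd x (V i) q (V i q).-1; rewrite Vi0 !expr0 !mulr1 => ->.
  by rewrite Eci mulrAC.
have c'0 : forall i, i \in S -> c' i = 0.
  apply: indep => [i iS|]; first by case: (Ec _ iS).
  apply: (@mulIf _ ('X - (x q)%:P)); first by rewrite polyXsubC_eq0.
  rewrite mul0r -[RHS]rel mulr_suml; apply: eq_bigr => i iS.
  by case: (Ec _ iS) => _ ->.
by move=> i iS; case: (Ec _ iS) => _ _; apply; apply: c'0.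
Qed.

(** * Condition (II) under the same operations and under merging *)

Lemma admissibleS n (T : finType) k (V : T -> 'I_n -> nat) (S S' : {set T}) :
  S' \subset S -> admissible k V S -> admissible k V S'.
Proof. by move=> S'S adm I IS'; apply: adm; apply: subset_trans IS' S'S. Qed.

(** A set [J] containing [i0] is compared with [J :\ i0 :|: I]: by tightness the vectors of [I]
    contribute k - |u|, exactly what [u] contributes at [i0], and a lower bound of [u] is one of all
    of [I]. *)
Lemma admissible_split n (T : finType) k (V : T -> 'I_n -> nat) (S I : {set T})
    i0 u : I \subset S -> i0 \in I -> lower V I u ->
  (\sum_(i in I) (k - weight (V i)) + weight u = k)%N ->
  admissible k V S ->
  admissible k (fun i => if i == i0 then u else V i) (i0 |: S :\: I).
Proof.
move=> IS i0I uV tight adm J JS J0 w wV.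
have neq i : i \in J -> i != i0 -> i \in S :\: I.
  by move=> iJ ii0; have := subsetP JS _ iJ; rewrite in_setU1 (negbTE ii0).
have [i0J|i0J] := boolP (i0 \in J); last first.
  have ni i : i \in J -> i != i0 by apply: contraTneq => ->.
  rewrite (eq_bigr (fun i => k - weight (V i))%N) => [|i /ni/negbTE -> //].
  apply: adm => // [|i iJ j].
    apply/subsetP => i iJ; have := neq _ iJ (ni _ iJ).
    by rewrite in_setD => /andP[].
  by have := wV _ iJ j; rewrite (negbTE (ni _ iJ)).
have sJ : J :\ i0 \subset S :\: I.
  by apply/subsetP => i; rewrite in_setD1 => /andP[ii0 iJ]; apply: neq.
have KI : (J :\ i0 :|: I) :&: I = I by rewrite setIUl setIid setUC setKI.
have KDI : (J :\ i0 :|: I) :\: I = J :\ i0.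
  rewrite setDUl setDv setU0; apply/setDidPl; rewrite disjoints_subset.
  by apply: subset_trans sJ _; rewrite setDE subsetIr.
have: (\sum_(i in J :\ i0 :|: I) (k - weight (V i)) + weight w <= k)%N.
  apply: adm => [||i].
  - by rewrite subUset IS andbT; apply: subset_trans sJ (subsetDl _ _).
  - by apply/set0Pn; exists i0; rewrite in_setU i0I orbT.
  rewrite in_setU => /orP[/setD1P[/negbTE ii0 /wV]|iI j]; first by rewrite ii0.
  by apply: leq_trans (uV _ iI j); have := wV _ i0J j; rewrite eqxx.
rewrite (big_setID I) /= KI KDI (big_setD1 i0 i0J) /= eqxx.
rewrite [in X in _ -> X](eq_bigr (fun i => k - weight (V i))%N).
  by move: tight; set a := bigop _ _ _; set b := bigop _ _ _; lia.
by move=> i /setD1P[/negbTE ->].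
Qed.

(** If a vector of [I] vanishes at [q], its term drops by one and no other term grows. Otherwise all
    terms stay, but raising [u] by one at [q] gives a lower bound of the old vectors. *)
Lemma admissible_div n (T : finType) k (V : T -> 'I_n -> nat) (S : {set T}) q :
  (forall i, i \in S -> (weight (V i) < k)%N) -> admissible k V S ->
  admissible k.-1 (fun i => upd (V i) q (V i q).-1) S.
Proof.
move=> ltk adm I IS I0 u uV.
have leV i j : (upd (V i) q (V i q).-1 j <= V i j)%N.
  by rewrite /upd; case: eqP => [->|_]; rewrite ?leq_pred.
have [/exists_inP[i0 i0I /eqP Vi0]|no0] := boolP [exists i in I, V i q == 0%N].
  have := adm I IS I0 u (fun i iI j => leq_trans (uV i iI j) (leV i j)).
  rewrite (bigD1 i0) //= [in X in _ -> X](bigD1 i0) //= weight_pred Vi0.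
  have: (\sum_(i in I | i != i0) (k.-1 - weight (upd (V i) q (V i q).-1)) <=
         \sum_(i in I | i != i0) (k - weight (V i)))%N.
    by apply: leq_sum => i _; rewrite weight_pred; lia.
  have := ltk _ (subsetP IS _ i0I).
  by set a := bigop _ _ _; set b := bigop _ _ _; lia.
have Vpos i : i \in I -> (0 < V i q)%N.
  by move=> iI; rewrite lt0n; apply: contra no0 => e; apply/exists_inP; exists i.
have u'V : lower V I (upd u q (u q).+1).
  move=> i iI j; have := uV i iI j; have := Vpos i iI; rewrite /upd.
  by case: eqP => [->|_]; first case: (V i q).
have := adm I IS I0 _ u'V; have := weight_upd u q (u q).+1.
rewrite [in X in _ -> X -> _](eq_bigr (fun i => k.-1 - weight (upd (V i) q (V i q).-1))%N).
  by set a := bigop _ _ _; lia.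
move=> i iI; have := Vpos _ iI; have := ltk _ (subsetP IS _ iI).
have := leq_coord_weight (V i) q.
by rewrite weight_pred; lia.
Qed.

(** If [V i] were below [V i'] everywhere, it would be a lower bound of the pair, and (II) would
    give k <= |V i'|. *)
Lemma admissible_pair n (T : finType) k (V : T -> 'I_n -> nat) (S : {set T}) i i' :
  i \in S -> i' \in S -> i != i' ->
  (weight (V i) < k)%N -> (weight (V i') < k)%N -> admissible k V S ->
  exists j, (V i' j < V i j)%N.
Proof.
move=> iS i'S ii' lti lti' adm; apply/existsP; apply: contraT.
rewrite negb_exists => /forallP noj.
have : (\sum_(l in [set i; i']) (k - weight (V l)) + weight (V i) <= k)%N.
  apply: adm => [||l].
  - by apply/subsetP => l /set2P[] ->.
  - by apply/set0Pn; exists i; rewrite set21.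
  - by case/set2P => -> j //; rewrite leqNgt.
by rewrite big_setU1 ?in_set1 //= big_set1; lia.
Qed.

(** A lower bound [u] of the merged vectors can exceed an old one only at [q], and by at most one
    since the coordinate [j] is 0/1. If [u q] is positive, [I] misses [i0] and is proper, so without
    tight sets (II) has one unit of slack once [I] has two elements. *)
Lemma admissible_merge n (T : finType) k (V : T -> 'I_n -> nat) (S : {set T})
    (j q : 'I_n) i0 : j != q ->
  (forall i, i \in S -> (V i j <= 1)%N) -> i0 \in S -> V i0 q = 0%N -> V i0 j = 0%N ->
  (forall (I : {set T}) u, I \proper S -> (1 < #|I|)%N -> lower V I u ->
     (\sum_(i in I) (k - weight (V i)) + weight u)%N != k) ->
  admissible k V S -> admissible k (fun i => merge j q (V i)) S.
Proof.
move=> jq V1 i0S Vi0q Vi0j nontight adm I IS I0 u uV.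
rewrite (eq_bigr (fun i => k - weight (V i)))%N => [|i _]; last by rewrite weight_merge.
have qj : q != j by rewrite eq_sym.
have uVq i : i \in I -> (u q <= V i q + V i j)%N.
  by move=> iI; have := uV i iI q; rewrite /merge upd_neq // upd_eq.
have uj : u j = 0%N.
  have [i iI] := set0Pn _ I0; apply/eqP; rewrite -leqn0.
  by have := uV i iI j; rewrite /merge upd_eq.
have uVo i l : i \in I -> l != j -> l != q -> (u l <= V i l)%N.
  by move=> iI lj lq; have := uV i iI l; rewrite /merge !upd_neq.
have uV' i : i \in I -> (u q <= V i q)%N -> forall l, (u l <= V i l)%N.
  move=> iI uq l; have [->|lj] := eqVneq l j; first by rewrite uj.
  by have [->//|lq] := eqVneq l q; apply: uVo.
have [uq0|uq_gt0] := posnP (u q).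
  by apply: adm => // i iI; apply: uV' => //; rewrite uq0.
have i0I : i0 \notin I.
  by apply/negP => /uVq; rewrite Vi0q Vi0j; lia.
have [/exists_inP[i2 i2I /eqP Vi2]|no2] := boolP [exists i in I, V i j == 0%N].
  (* A singleton may lack slack, but its vector vanishes at [j], so [u] is already below it. *)
  have [I1|I1] := leqP #|I| 1.
    have /eqP/cards1P[i EI] : #|I| = 1%N.
      by apply/eqP; rewrite eqn_leq I1 card_gt0.
    move: i2I; rewrite EI => /set1P i2i; rewrite -EI; apply: adm => // i'.
    rewrite EI => /set1P ->; rewrite -i2i.
    have i2I : i2 \in I by rewrite EI i2i set11.
    by apply: uV' => //; have := uVq _ i2I; rewrite Vi2 addn0.
  have ltIS : I \proper S by apply/properP; split=> //; exists i0.
  (* The slack pays for the unit removed at [q]. *)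
  have lowu : lower V I (upd u q (u q).-1).
    move=> i iI l; have [->|lj] := eqVneq l j; first by rewrite upd_neq // uj.
    have [->|lq] := eqVneq l q; last by rewrite upd_neq //; apply: uVo.
    by rewrite upd_eq; move: (uVq _ iI) (V1 _ (subsetP IS _ iI)); clear; lia.
  have := nontight _ _ ltIS I1 lowu; have := adm _ IS I0 _ lowu.
  by have := weight_upd u q (u q).-1; set a := bigop _ _ _; lia.
(* All vectors of [I] are 1 at [j], so a unit of [u] moves back from [q] to [j] and the weight is
   kept. *)
have lowu : lower V I (upd (upd u q (u q).-1) j 1).
  move=> i iI l; have [->|lj] := eqVneq l j.
    rewrite upd_eq lt0n; apply: contra no2 => Vi; by apply/exists_inP; exists i.
  rewrite upd_neq //.
  have [->|lq] := eqVneq l q; last by rewrite upd_neq //; apply: uVo.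
  by rewrite upd_eq; move: (uVq _ iI) (V1 _ (subsetP IS _ iI)); clear; lia.
have := adm _ IS I0 _ lowu.
have := weight_upd (upd u q (u q).-1) j 1; rewrite (upd_neq _ _ jq) uj.
by have := weight_upd u q (u q).-1; set a := bigop _ _ _; lia.
Qed.

(** * The induction *)

Lemma independent_mpoly (F : fieldType) n (T : finType) k (V : T -> 'I_n -> nat)
    (S : {set T}) (p q : 'I_n) : p != q ->
  (forall i, i \in S -> forall j, j != p -> j != q -> (V i j <= 1)%N) ->
  admissible k V S -> independent (fun j => 'X_j : {mpoly F[n]}) k V S.
Proof.
move=> pq.
pose off (v : 'I_n -> nat) := (\sum_(j | (j != p) && (j != q)) v j)%N.
(* Dividing lowers [k], dropping and splitting lower the number of vectors, and merging lowers the
   sum of [off]; the other summands never grow. *)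
have [N] := ubnP (k + #|S| + \sum_(i in S) off (V i))%N.
elim: N => // N IH in k V S *; rewrite ltnS => leN V01 adm.
have [/exists_inP[i0 i0S ki0]|nolarge] := boolP [exists i in S, k <= weight (V i)]%N.
  apply: (independent_drop i0S ki0); apply: IH.
  - move: leN; rewrite (cardsD1 i0 S) i0S (big_setD1 i0) //=.
    by set a := bigop _ _ _; lia.
  - by move=> i /setD1P[_ iS]; apply: V01.
  - by apply: admissibleS adm; apply: subsetDl.
have ltk i : i \in S -> (weight (V i) < k)%N.
  by move=> iS; rewrite ltnNge; apply: contra nolarge => ki; apply/exists_inP; exists i.
have Xinj := @mpolyXU_inj F n.
pose A := [set i in S | V i q == 0%N].
have [A1|A2] := leqP #|A| 1.
  have [->|[i1 i1S]] := set_0Vmem S; first by move=> c _ _ i; rewrite in_set0.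
  apply: (independent_div (q := q) Xinj ltk) => [i i' iS i'S Vi Vi'|].
    by apply: (card_le1_eqP A1); rewrite in_set ?iS ?i'S ?Vi ?Vi'.
  apply: IH; last exact: admissible_div.
    rewrite (eq_bigr (fun i => off (V i))) => [|i _].
      by move: leN (ltk _ i1S); set a := bigop _ _ _; lia.
    by rewrite /off; apply: eq_bigr => j /andP[_ jq]; rewrite upd_neq.
  by move=> i iS j jp jq; rewrite upd_neq //; apply: V01.
have /card_gt1P[i1 [i2 [/setIdP[i1S /eqP Vi1] /setIdP[i2S /eqP Vi2] i12]]] := A2.
(* Comparing [i1] and [i2] both ways gives two coordinates with opposite strict inequalities.
   Neither is [q], where both vectors vanish, and they cannot both be [p]. *)
have [j [i [i' [jp jq [iS Vi] [i'S Vi']]]]] : exists j i i',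
    [/\ j != p, j != q, i \in S /\ V i q = 0%N & i' \in S /\ (V i j < V i' j)%N].
  have [j1 ltj1] := admissible_pair i1S i2S i12 (ltk _ i1S) (ltk _ i2S) adm.
  rewrite eq_sym in i12.
  have [j2 ltj2] := admissible_pair i2S i1S i12 (ltk _ i2S) (ltk _ i1S) adm.
  have j1q : j1 != q by apply: contraTneq ltj1 => ->; rewrite Vi1.
  have j2q : j2 != q by apply: contraTneq ltj2 => ->; rewrite Vi2.
  have [j1p|j1p] := eqVneq j1 p; last by exists j1, i2, i1.
  have [j2p|j2p] := eqVneq j2 p; last by exists j2, i1, i2.
  by move: ltj1 ltj2; rewrite j1p j2p; lia.
have Vij : V i j = 0%N by have := V01 _ i'S j jp jq; lia.
move=> c size_c rel i0 i0S; apply/eqP/contraT => ci0.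
(* A tight set would yield [c i0 = 0] by splitting, against [ci0]. *)
have nontight (I : {set T}) u : I \proper S -> (1 < #|I|)%N -> lower V I u ->
    (\sum_(i in I) (k - weight (V i)) + weight u)%N != k.
  move=> IS I1 uV; apply: contra ci0 => /eqP tight; apply/eqP.
  have [i3 i3I] : exists i, i \in I by apply/card_gt0P/ltnW.
  have sIS := proper_sub IS.
  apply: (independent_split sIS i3I uV) size_c rel i0 i0S.
    apply: IH; last exact: admissibleS adm.
      move: leN (proper_card IS); rewrite [X in (_ + X <= _)%N -> _](big_setID I) /=.
      rewrite (setIidPr sIS); set a := bigop _ _ _; set b := bigop _ _ _.
      by move: a b; clear; lia.
    by move=> l lI; apply: V01; apply: (subsetP sIS).
  apply: IH; last exact: admissible_split.
    have i3SI : i3 \notin S :\: I by rewrite in_setD i3I.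
    rewrite cardsU1 i3SI big_setU1 //= eqxx.
    have offu : (off u <= off (V i3))%N by apply: leq_sum => l _; apply: uV.
    rewrite (eq_bigr (fun l => off (V l))) => [|l lSI]; last first.
      by case: eqP lSI => // ->; rewrite (negbTE i3SI).
    move: leN; rewrite [X in (_ + X <= _)%N -> _](big_setID I) /= (setIidPr sIS).
    rewrite (big_setD1 i3 i3I) /=; have := cardsID I S; rewrite (setIidPr sIS).
    set a := bigop _ _ _; set b := bigop _ _ _.
    by move: a b I1 offu; clear; lia.
  move=> l /setU1P[->|]; first rewrite eqxx => l' l'p l'q.
    by apply: leq_trans (uV _ i3I l') (V01 _ (subsetP sIS _ i3I) _ l'p l'q).
  rewrite in_setD => /andP[lI lS]; case: eqP lI => [->|_ _]; first by rewrite i3I.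
  exact: V01.
suff indep : independent (fun j => 'X_j : {mpoly F[n]}) k V S.
  by rewrite (indep c size_c rel i0 i0S) eqxx in ci0.
apply: (@independent_merge _ _ (fun j => 'X_j) _ _ _ _ j q (comp_mpoly (mergeX F j q))
  ('X_j - 'X_q) (fun f => msize f)) => //.
- by rewrite subr_eq0 (inj_eq Xinj).
- by move=> l; apply: comp_mergeX.
- exact: comp_mergeX_ker.
- by move=> f; apply: msize_mul_subX.
have mergeo v l : l != j -> l != q -> merge j q v l = v l.
  by move=> lj lq; rewrite /merge !upd_neq.
have off_merge v : (off (merge j q v) + v j = off v)%N.
  rewrite /off (bigD1 j) ?jp //= [in RHS](bigD1 j) ?jp //= /merge upd_eq add0n addnC.
  congr (_ + _)%N; apply: eq_bigr => l /andP[/andP[_ lq] lj].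
  by rewrite !upd_neq.
apply: IH.
(* Merging lowers each [off] by the coordinate [j], which is positive at [i']. *)
- apply: leq_trans leN; rewrite ltn_add2l (bigD1 i') //= [ltnRHS](bigD1 i') //=.
  rewrite -addSn leq_add //; last first.
    by apply: leq_sum => l _; rewrite -(off_merge (V l)) leq_addr.
  by rewrite -(off_merge (V i')) -addn1 leq_add2l; apply: leq_ltn_trans Vi'.
- move=> l lS l' l'p l'q; have [->|l'j] := eqVneq l' j; first by rewrite /merge upd_eq.
  by rewrite mergeo //; apply: V01.
- by apply: admissible_merge Vi Vij nontight adm => // l lS; apply: V01.
Qed.

(** * Passage to the fraction field and to lists of polynomials *)

Lemma tofrac_common_denom (D : idomainType) (s : seq {fraction D}) :
  exists (d : D) (g : {fraction D} -> D), d != 0 /\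
    {in s, forall y, tofrac d * y = tofrac (g y)}.
Proof.
elim: s => [|y s [d [g [d0 Eg]]]].
  by exists 1, (fun=> 0); rewrite oner_neq0.
have [a [b [b0 Ey]]] : exists a b : D, b != 0 /\ tofrac b * y = tofrac a.
  elim/quotW: y => y; exists (frac y).1, (frac y).2; split; first exact: denom_ratioP.
  (* On representatives, equality of fractions is cross-multiplication. *)
  apply/eqP; unlock tofrac; rewrite -[X in X == _]FracField.pi_mul piE.
  rewrite /FracField.equivf /FracField.mulf !numden_Ratio ?(oner_eq0, mulf_neq0, denom_ratioP) //.
  by rewrite mulr1 mul1r mulrC.
exists (d * b), (fun z => if z == y then d * a else b * g z).
split; first by rewrite mulf_neq0.
move=> z; rewrite inE; have [-> _|_ /= zs] := eqVneq z y.
  by rewrite !tofracM -mulrA Ey.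
by rewrite !tofracM [tofrac d * _]mulrC -mulrA Eg.
Qed.

(** Splits the flat index of a concatenation into a block and a position, hiding the offsets in [C];
    the second clause carries vanishing back to the flat coefficients. *)
Lemma sum_nth_flatten (K : fieldType) (E : lmodType K) (T : eqType)
    (B : T -> seq E) (r : seq T) (c : nat -> K) : uniq r ->
  exists C : T -> nat -> K,
    \sum_(t < size (flatten (map B r))) c t *: (flatten (map B r))`_t =
      \sum_(i <- r) \sum_(e < size (B i)) C i e *: (B i)`_e
  /\ ((forall i e, i \in r -> (e < size (B i))%N -> C i e = 0) ->
      forall t, (t < size (flatten (map B r)))%N -> c t = 0).
Proof.
elim: r c => [|i r IH] c /=; first by exists (fun=> fun=> 0); rewrite big_nil big_ord0.
move=> /andP[ir /(IH (fun t => c (size (B i) + t)%N))[C [EC C0]]].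
exists (fun l e => if l == i then c e else C l e); split.
  rewrite size_cat big_split_ord /= big_cons eqxx; congr (_ + _).
    by apply: eq_bigr => t _; rewrite nth_cat ltn_ord.
  rewrite [in RHS]big_seq_cond.
  rewrite (eq_bigr (fun l => \sum_(e < size (B l)) C l e *: (B l)`_e)); last first.
    by move=> l /andP[lr _]; case: eqP lr => [->|//]; rewrite (negbTE ir).
  rewrite -big_seq_cond -EC; apply: eq_bigr => t _.
  by rewrite nth_cat ltnNge leq_addr /= addKn.
move=> H t; rewrite size_cat; have [lt _|ge lt] := ltnP t (size (B i)).
  by have := H i t; rewrite eqxx inE eqxx; apply.
rewrite -(subnKC ge); apply: C0; last by rewrite ltn_subLR.
move=> l e lr le; have := H l e; rewrite inE lr orbT.
by case: eqP lr => [->|_ _]; [rewrite (negbTE ir) | apply].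
Qed.

Lemma property_V_admissible (k m n : nat) (V : 'I_m -> 'X_{1..n}) l :
  property_V l k V -> admissible k (fun i => V i) [set: 'I_m].
Proof.
move=> [_ V_II _] I _ I0 u uV; apply: leq_trans (V_II I I0).
rewrite (eq_bigr (fun i => k - mdeg (V i)))%N => [|i _]; last by rewrite mdegE.
rewrite leq_add2l mdegE; apply: leq_sum => j _; rewrite mnmE.
elim/big_ind: _ => [|a b ua ub|i iI]; last exact: uV.
  (* The default value of the minimum is a maximum over the nonempty [I], hence also at least
     [u j]. *)
  have [i iI] := set0Pn _ I0; apply: leq_trans (uV i iI j) _.
  exact: (leq_bigmax_cond (F := fun i => V i j)).
by rewrite leq_min ua.
Qed.

Lemma map_tofrac_root_poly (F : fieldType) n (v : 'X_{1..n}) :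
  map_poly (@tofrac {mpoly F[n]}) (root_poly (fun j => 'X_j) v) =
  \prod_(j < n) ('X - (ratvar F j)%:P) ^+ v j.
Proof.
rewrite /root_poly rmorph_prod; apply: eq_bigr => j _.
by rewrite rmorphXn /= rmorphB /= map_polyX map_polyC.
Qed.

(** A common denominator turns the scalars of each block into the coefficients of one polynomial
    over F[x_1, ..., x_n]. As this ring embeds in its fraction field, the relation descends to
    it. *)
Lemma lin_indep_Pfam (F : fieldType) (k m n : nat) (V : 'I_m -> 'X_{1..n}) :
  independent (fun j => 'X_j : {mpoly F[n]}) k (fun i => V i) [set: 'I_m] ->
  lin_indep (Pfam F k V).
Proof.
move=> indep c rel.
(* Extension by 0 to all naturals, as block offsets require. *)
pose c' t := if insub t is Some i then c i else 0.
have c'E i : c' (val i) = c i by rewrite /c' valK.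
have [C [EC C0]] := sum_nth_flatten (fun i => Pvec F k (V i)) c' (enum_uniq 'I_m).
suff C_eq0 i e : (e < k - mdeg (V i))%N -> C i e = 0.
  move=> i; rewrite -c'E; apply: C0 => [l e _|]; last exact: ltn_ord.
  by rewrite size_map size_iota; apply: C_eq0.
have [d [g [d0 Eg]]] :=
  tofrac_common_denom [seq C i e | i <- enum 'I_m, e <- iota 0 (k - mdeg (V i))].
have {}Eg l f : (f < k - mdeg (V l))%N -> tofrac d * C l f = tofrac (g (C l f)).
  move=> lt; apply: Eg; apply/allpairsPdep; exists l, f.
  by rewrite mem_enum mem_iota.
pose b l := \poly_(f < k - mdeg (V l)) g (C l f).
have Eb l : map_poly (@tofrac {mpoly F[n]}) (b l) =
    \sum_(f < k - mdeg (V l)) (tofrac d * C l f) *: 'X^f.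
  rewrite /b poly_def rmorph_sum; apply: eq_bigr => f _.
  by rewrite Eg // -mul_polyC rmorphM /= map_polyC map_polyXn mul_polyC.
have b0 : forall l, l \in [set: 'I_m] -> b l = 0.
  apply: indep => [l _|]; first by rewrite /weight -mdegE; apply: size_poly.
  have tofrac_inj : injective (@tofrac {mpoly F[n]}).
    by move=> y z /eqP; rewrite tofrac_eq => /eqP.
  apply: (map_inj_poly tofrac_inj (tofrac0 _)).
  rewrite rmorph0 -[RHS](scaler0 _ (tofrac d)) -[in RHS]rel.
  rewrite [in RHS](eq_bigr (fun i : 'I__ => c' i *: (Pfam F k V)`_i)) => [|j _]; last first.
    by rewrite c'E.
  rewrite {}EC big_enum scaler_sumr rmorph_sum.
  apply: eq_big => [l|l _]; first by rewrite inE.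
  rewrite rmorphM /= map_tofrac_root_poly Eb size_map size_iota.
  rewrite scaler_sumr mulr_suml; apply: eq_bigr => f _.
  by rewrite (nth_map 0%N) ?size_iota // nth_iota // add0n -scalerAl scalerA [_ * 'X^f]mulrC.
move=> lt; have := congr1 (fun y : {poly _} => y`_e) (b0 i (in_setT i)).
rewrite coef_poly lt coef0 => g0; have /eqP := Eg i e lt.
by rewrite g0 tofrac0 mulf_eq0 tofrac_eq0 (negbTE d0) => /eqP.
Qed.

Theorem theorem5p1 (F : finFieldType) (k m n : nat) (V : 'I_m -> 'X_{1..n})
    (k_ge1 : (1 <= k)%N) (m_ge1 : (1 <= m)%N) (n_ge2 : (2 <= n)%N)
    (VP : property_V 2 k V) :
  lin_indep (Pfam F k V).
Proof.
apply: lin_indep_Pfam; have lt1 : (n - 1 < n)%N by lia.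
have lt2 : (n - 2 < n)%N by lia.
(* Counting from 0, the last two coordinates, free of the 0/1 condition, are n - 2 and n - 1. *)
apply: (@independent_mpoly _ _ _ _ _ _ (Ordinal lt2) (Ordinal lt1)).
- by rewrite -val_eqE /=; lia.
- move=> i _ j; rewrite -!val_eqE /= => j2 j1; case: VP => _ _ V01.
  have /V01 : (j < n - 2)%N by have := ltn_ord j; lia.
  by move=> /(_ i); rewrite !inE => /orP[] /eqP ->.
- exact: property_V_admissible VP.
Qed.
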